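(* Let $r \ge 1$ be a fixed integer and $n > r$. Consider the Markov chain $(H_t)_{t \ge 1}$ on the $r$-element subsets of $[n] = \{1,\ldots,n\}$ in which $H_1$ is uniformly random and, given $H_t$, $H_{t+1}$ is obtained by choosing a uniformly random element of $H_t$ and replacing it with a uniformly random element of $[n] \setminus H_t$. Let $T^{(r,r)}_{\mathrm{RW}}$ be the smallest $k$ such that every $r$-element subset of $[n]$ equals $H_t$ for some $t \le k$. Then, as $n \to \infty$, \[ \mathbb{E}\, T^{(r,r)}_{\mathrm{RW}} = \binom{n}{r}\log\binom{n}{r}\,(1+o(1)). \] *)

(* Defs.v *)
From HB Require Import structures.
From mathcomp Require Import all_boot all_order all_algebra.
From mathcomp Require Import all_classical all_reals all_analysis.
Set Implicit Arguments. Unset Strict Implicit. Unset Printing Implicit Defensive.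
Import Order.TTheory GRing.Theory Num.Theory.
Local Open Scope ring_scope.

Definition init_prob (R : realType) (n r : nat) (A : {set 'I_n}) : R :=
  if #|A| == r then ('C(n, r)%:R)^-1 else 0.

(* Transition probability: remove a uniform element of A, add a uniform
   element of [n] \ A.  Each of the r*(n-r) choices gives a distinct B with
   |A cap B| = r-1, so P(A,B) = 1/(r(n-r)) for such B and 0 otherwise. *)
Definition trans_prob (R : realType) (n r : nat) (A B : {set 'I_n}) : R :=
  if [&& #|A| == r, #|B| == r & #|A :&: B| == r.-1]
  then ((r * (n - r))%:R)^-1 else 0.

Fixpoint path_w_from (R : realType) (n r : nat) (x : {set 'I_n})
    (s : seq {set 'I_n}) : R :=
  match s with
  | [::] => 1
  | y :: s' => trans_prob R r x y * path_w_from R r y s'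
  end.

Definition path_prob (R : realType) (n r : nat) (s : seq {set 'I_n}) : R :=
  match s with
  | [::] => 1
  | x :: s' => init_prob R r x * path_w_from R r x s'
  end.

Definition covered (n r : nat) (s : seq {set 'I_n}) : bool :=
  [forall A : {set 'I_n}, (#|A| == r) ==> (A \in s)].

(* P(T > k) = P(H_1, ..., H_k do not cover all r-subsets) *)
Definition tail_prob (R : realType) (n r k : nat) : R :=
  \sum_(s : k.-tuple {set 'I_n}) path_prob R r (tval s) * (~~ covered r (tval s))%:R.

(* E T = sum_{k >= 0} P(T > k), valued in the extended reals. *)
Definition expected_cover_time (R : realType) (n r : nat) : \bar R :=
  (\sum_(0 <= k <oo) (tail_prob R n r k)%:E)%E.

(* Main.v *)
Require Import Defs.
From HB Require Import structures.
From mathcomp Require Import all_boot all_order all_algebra.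
From mathcomp Require Import all_classical all_reals all_analysis.
From mathcomp Require Import ring lra zify.
Import Order.TTheory GRing.Theory Num.Theory.
Import numFieldNormedType.Exports.
Local Open Scope classical_set_scope.
Local Open Scope ring_scope.

(** Let [N = 'C(n, r)], let [h(x, y)] be the expected hitting time of [y] from [x],
    and let [H_m] be the harmonic numbers.  If [c <= h] (resp. [h <= c]) off the
    diagonal, Matthews' method bounds the expected cover time below (resp. above)
    by [1 + c H_(N-1)].  No random ordering of the states is needed: writing [U] for
    the set of unvisited states, [c H_|U| + |U|^-1 sum_(y in U) (h(x, y) - c)] drops
    by exactly 1 in mean at each step before [U] is updated, and updating [U] moves
    it in the direction given by the sign of [h - c].

    The hitting time of [Y] from [A] depends only on the distance [|A \ Y|], which is
    a birth-and-death chain, so it is explicit.  It equals [N - 1] at distance 1, and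
    each further unit of distance costs only [O(N / n)]; hence both bounds are
    [N ln N (1 + o(1))]. *)

(** * Matthews' method for a finite Markov chain *)

(** The probability that [k] steps from [x] leave part of [U] unvisited. Only the states after [x]
    count as visits. *)
Fixpoint uncovered_prob {R : realType} {T : finType} (P : T -> T -> R)
    (k : nat) (x : T) (U : {set T}) : R :=
  if k is k'.+1 then \sum_y P x y * uncovered_prob P k' y (U :\ y)%SET
  else (U != finset.set0)%:R.

Section Matthews.
Context {R : realType} {T : finType}.
Implicit Types (x y z : T) (U : {set T}) (k : nat) (c : R).
Variables (P : T -> T -> R) (X : {set T}) (h : T -> T -> R).
Hypothesis P_ge0 : forall x y, 0 <= P x y.
Hypothesis P_sum1 : forall x, x \in X -> \sum_y P x y = 1.
Hypothesis P_out : forall x y, y \notin X -> P x y = 0.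
Hypothesis h_diag : forall x, h x x = 0.
Hypothesis h_step : forall x y, x \in X -> y \in X -> x != y ->
  \sum_z P x z * h z y = h x y - 1.

(* A lower or upper bound, according to the sign of [h - c], for the expected time to
   visit all of [U] from [x \notin U]. *)
Definition matthews c x U : R :=
  c * series harmonic #|U| + #|U|%:R^-1 * \sum_(y in U) (h x y - c).

Lemma matthews0 c x : matthews c x finset.set0 = 0.
Proof. by rewrite /matthews cards0 /series /= big_geq // big_set0 !mulr0 addr0. Qed.

Lemma matthews_le c x U : (forall y, y \in U -> h x y <= c) ->
  matthews c x U <= c * series harmonic #|U|.
Proof.
move=> hc; rewrite gerDl mulr_ge0_le0 ?invr_ge0// sumr_le0// => y yU.
by rewrite subr_le0 hc.
Qed.

Lemma matthews_ge c x U : (forall y, y \in U -> c <= h x y) ->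
  c * series harmonic #|U| <= matthews c x U.
Proof.
move=> hc; rewrite lerDl mulr_ge0 ?invr_ge0// sumr_ge0// => y yU.
by rewrite subr_ge0 hc.
Qed.

Lemma matthews_step c x U : x \in X -> U \subset X -> x \notin U ->
  (U != finset.set0)%:R + \sum_z P x z * matthews c z U = matthews c x U.
Proof.
move=> xX UX xU; have [->|U0] := eqVneq U finset.set0.
  by rewrite matthews0 add0r big1 // => z _; rewrite matthews0 mulr0.
have -> : \sum_z P x z * matthews c z U = c * series harmonic #|U| +
    #|U|%:R^-1 * \sum_(y in U) \sum_z P x z * (h z y - c).
  under eq_bigr => z _ do rewrite mulrDr.
  rewrite big_split /= -mulr_suml P_sum1// mul1r; congr (_ + _).
  rewrite exchange_big /= mulr_sumr; apply: eq_bigr => z _.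
  by rewrite mulrCA mulr_sumr.
under eq_bigr => y yU.
  under eq_bigr do rewrite mulrBr.
  rewrite sumrB -mulr_suml P_sum1// mul1r h_step//; last 2 first.
    exact: (fintype.subsetP UX).
    by apply: contraNneq xU => ->.
  rewrite addrAC; over.
rewrite /matthews sumrB sumr_const mulrBr mulVf; last first.
  by rewrite pnatr_eq0 -lt0n card_gt0.
by rewrite addrC -!addrA [X in _ + (_ + X)]addrC subrr addr0.
Qed.

(* For [z \in U] the summand [h z z - c = - c] turns [c * H_|U|] into [c * H_(|U|-1)], so
   only the weights of the remaining summands change. *)
Lemma matthews_visit c z U :
  exists2 a : R, 0 <= a &
    matthews c z (U :\ z)%SET = matthews c z U + a * \sum_(y in (U :\ z)%SET) (h z y - c).
Proof.
have [zU|zU] := boolP (z \in U); last first.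
  exists 0 => //; rewrite mul0r addr0; congr (matthews _ _ _).
  by apply/finset.setDidPl; rewrite disjoint_sym disjoints1.
have := cardsD1 z U; rewrite zU /= add1n => E.
(* If [U] is [{z}], the general weight would be [0^-1 - 1 = -1], as [0^-1 = 0]. Both values of
   [matthews] are 0 here, so [a = 0] serves. *)
have [E0|n0] := eqVneq #|(U :\ z)%SET| 0%N.
  exists 0 => //; rewrite mul0r addr0.
  rewrite /matthews E E0 /series /= big_geq// big_nat1 /harmonic /= [\sum_(y in U) _](big_setD1 z)//=.
  move/eqP: E0; rewrite cards_eq0 => /eqP ->.
  rewrite !big_set0 h_diag.
  ring.
exists (#|(U :\ z)%SET|%:R^-1 - #|U|%:R^-1).
  rewrite subr_ge0 lef_pV2 ?posrE ?ltr0n ?ler_nat ?E// lt0n//.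
rewrite /matthews E /series /= big_nat_recr //= [\sum_(y in U) _](big_setD1 z)//= h_diag.
rewrite /harmonic /=.
ring.
Qed.

(** First-step analysis: if [T] is the time to visit all of [U], the sum over [i < k] is the mean of
    [min(T, k)]. *)
Lemma sum_uncovered_prob k x U :
  \sum_(i < k.+1) uncovered_prob P i x U =
  (U != finset.set0)%:R + \sum_y P x y * \sum_(i < k) uncovered_prob P i y (U :\ y)%SET.
Proof.
rewrite big_ord_recl /=; congr (_ + _).
by rewrite exchange_big /=; apply: eq_bigr => y _; rewrite mulr_sumr.
Qed.

Lemma uncovered_prob_ge0 k x U : 0 <= uncovered_prob P k x U.
Proof.
by elim: k x U => [|k IH] x U /=; rewrite ?ler0n// sumr_ge0// => y _; rewrite mulr_ge0.
Qed.

Lemma ler_sum_P x (f g : T -> R) : (forall y, y \in X -> f y <= g y) ->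
  \sum_y P x y * f y <= \sum_y P x y * g y.
Proof.
move=> fg; apply: ler_sum => y _.
have [yX|yX] := boolP (y \in X); first by rewrite ler_wpM2l// fg.
by rewrite P_out// !mul0r.
Qed.

Lemma sub_setD1 x U : U \subset X -> (U :\ x)%SET \subset X.
Proof. exact/fintype.subset_trans/subD1set. Qed.

(** Induction on the truncation [k]: [matthews_step] pays for one step, and since [h <= c] the
    correction in [matthews_visit] only lowers the value. *)
Lemma matthews_upper c k x U :
  (forall x y, x \in X -> y \in X -> x != y -> 0 <= h x y <= c) ->
  x \in X -> U \subset X -> x \notin U ->
  \sum_(i < k) uncovered_prob P i x U <= matthews c x U.
Proof.
move=> hc; elim: k x U => [|k IH] x U xX UX xU.
  rewrite big_ord0 /matthews.
  have [->|U0] := eqVneq U finset.set0.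
    by have := matthews0 c x; rewrite /matthews => ->.
  have hU z : z \in U -> 0 <= h x z <= c.
    move=> zU; apply: hc => //; first exact: (fintype.subsetP UX).
    by apply: contraNneq xU => ->.
  have [y /hU/andP[h0 /(le_trans h0) c0]] := set0Pn _ U0.
  (* The bound is [c (H_|U| - 1)] plus the mean of [h x] over [U]; both are nonnegative, as
     [H_|U| >= 1]. *)
  rewrite sumrB sumr_const mulrBr -[c *+ _]mulr_natl mulrA mulVf ?mul1r; last first.
    by rewrite pnatr_eq0 -lt0n card_gt0.
  rewrite addrCA addr_ge0//.
    by rewrite mulr_ge0// sumr_ge0// => z /hU/andP[].
  rewrite -{2}[c]mulr1 -mulrBr mulr_ge0// subr_ge0.
  have : (0 < #|U|)%N by rewrite card_gt0.
  case: #|U| => // m _; rewrite /series /= big_nat_recl//= /harmonic /= invr1 lerDl.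
  by rewrite sumr_ge0// => i _; rewrite invr_ge0.
rewrite sum_uncovered_prob -[leRHS]matthews_step// lerD2l.
apply: ler_sum_P => y yX.
apply: le_trans (IH _ _ yX (sub_setD1 _ _ UX) _) _; first by rewrite !inE eqxx.
have [a a0 ->] := matthews_visit c y U.
rewrite gerDl mulr_ge0_le0// sumr_le0// => z /setD1P[zy zU].
have yz : y != z by rewrite eq_sym.
by rewrite subr_le0; case/andP: (hc y z yX (fintype.subsetP UX _ zU) yz).
Qed.

(** Stopping after [k] steps loses at most [C] if part of [U] is still unvisited, and nothing
    otherwise because [matthews] vanishes at the empty set. *)
Lemma matthews_lower c C k x U :
  (forall x y, x \in X -> y \in X -> x != y -> c <= h x y) ->
  (forall x U, matthews c x U <= C) ->
  x \in X -> U \subset X -> x \notin U ->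
  matthews c x U <= \sum_(i < k) uncovered_prob P i x U + C * uncovered_prob P k x U.
Proof.
move=> hc hC; elim: k x U => [|k IH] x U xX UX xU.
  rewrite big_ord0 add0r /=; have [->|U0] := eqVneq U finset.set0.
    by rewrite matthews0 mulr0.
  by rewrite mulr1.
rewrite sum_uncovered_prob -[leLHS]matthews_step// -addrA lerD2l /=.
rewrite mulr_sumr -big_split /=; under [leRHS]eq_bigr => y _ do rewrite mulrCA -mulrDr.
apply: ler_sum_P => y yX.
apply: le_trans (IH _ _ yX (sub_setD1 _ _ UX) _); last by rewrite !inE eqxx.
have [a a0 ->] := matthews_visit c y U.
rewrite lerDl mulr_ge0// sumr_ge0// => z /setD1P[zy zU].
by rewrite subr_ge0 (hc y z yX (fintype.subsetP UX _ zU))// eq_sym.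
Qed.

End Matthews.

(** * Auxiliary facts on tuples and binomials *)

Lemma sum_tuple_cons {V : nmodType} {T : finType} (k : nat) (F : k.+1.-tuple T -> V) :
  \sum_t F t = \sum_x \sum_(s : k.-tuple T) F [tuple of x :: s].
Proof.
rewrite pair_big /= (reindex (fun p : T * k.-tuple T => [tuple of p.1 :: p.2])) //.
exists (fun t => (thead t, [tuple of behead t])) => [[x s] _|t _] /=.
  by congr pair; apply: val_inj.
by rewrite -tuple_eta.
Qed.

Lemma leq_bin_id (n k : nat) : (0 < k < n)%N -> (n <= 'C(n, k))%N.
Proof.
elim: n k => // n IH [//|k] /=; rewrite ltnS leq_eqVlt => /predU1P[<-|kn].
  by rewrite binSn.
by rewrite binS -addn1 leq_add ?IH// bin_gt0 ltnW// ltnW.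
Qed.

(** * The walk on [r]-subsets: path sums and swaps *)

Section Johnson.
Context {R : realType} {n r : nat}.
Implicit Types (A B Y : {set 'I_n}) (U : {set {set 'I_n}}) (k : nat).

Definition rsets : {set {set 'I_n}} := [set A : {set 'I_n} | #|A| == r]%SET.

(** The path [B :: s] contains [U] iff [s] contains [U :\ B], so path sums obey the first-step
    recursion. *)
Lemma sum_path_w_from k A U :
  \sum_(s : k.-tuple {set 'I_n})
      path_w_from R r A s * (~~ (U \subset (s : seq _)))%:R =
  uncovered_prob (trans_prob R r) k A U.
Proof.
elim: k A U => [|k IH] A U /=.
  rewrite (big_pred1 [tuple]) => [|s]; last by rewrite [s]tuple0 /= eqxx.
  rewrite mul1r; congr (~~ _)%:R; apply/idP/eqP => [/fintype.subsetP sub|->].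
    by apply/setP => x; rewrite inE; apply/negP => /sub.
  by apply/fintype.subsetP => x; rewrite inE.
rewrite sum_tuple_cons; apply: eq_bigr => B _; rewrite -IH mulr_sumr.
apply: eq_bigr => s _ /=; rewrite mulrA; congr (_ * (~~ _)%:R).
apply/fintype.subsetP/fintype.subsetP => sub x.
  by move=> /setD1P[xB /sub]; rewrite inE (negPf xB).
by move=> xU; rewrite inE; case: eqVneq => //= xB; apply: sub; apply/setD1P.
Qed.

Lemma coveredE (s : seq {set 'I_n}) : covered r s = (rsets \subset s).
Proof.
apply/forallP/fintype.subsetP => [cov A|sub A].
  by rewrite inE => Ar; have := cov A; rewrite Ar.
by apply/implyP => Ar; apply: sub; rewrite inE.
Qed.

(** [H_1] already counts as a visit: [k.+1] states are [k] steps after [A], with [A] struck off the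
    targets. *)
Lemma tail_probS k : tail_prob R n r k.+1 =
  \sum_A init_prob R r A * uncovered_prob (trans_prob R r) k A (rsets :\ A)%SET.
Proof.
rewrite /tail_prob sum_tuple_cons; apply: eq_bigr => A _.
rewrite -sum_path_w_from mulr_sumr; apply: eq_bigr => s _ /=.
rewrite mulrA coveredE; congr (_ * (~~ _)%:R).
apply/fintype.subsetP/fintype.subsetP => sub x.
  by move=> /setD1P[xB /sub]; rewrite inE (negPf xB).
by move=> xU; rewrite inE; case: eqVneq => //= xB; apply: sub; apply/setD1P.
Qed.

Lemma tail_prob0 : (r <= n)%N -> tail_prob R n r 0 = 1.
Proof.
move=> rn; rewrite /tail_prob (big_pred1 [tuple]) => [|s]; last by rewrite [s]tuple0 /= eqxx.
rewrite mul1r coveredE (_ : rsets \subset _ = false) //.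
apply/negP => /subset_leq_card; rewrite card0 leqn0 cards_eq0 -cards_eq0.
by rewrite card_draws card_ord -leqn0 leqNgt bin_gt0 rn.
Qed.

Definition swap A (p : 'I_n * 'I_n) : {set 'I_n} := (p.2 |: A :\ p.1)%SET.

(** Additive, to avoid truncated subtraction. [Y = setT] gives the size of a swap, [Y = A] its
    adjacency to [A], and a complement its distance to a target. *)
Lemma card_swapI A Y a b : a \in A -> b \notin A ->
  (#|swap A (a, b) :&: Y| + (a \in Y) = #|A :&: Y| + (b \in Y))%N.
Proof.
move=> aA bA; rewrite /swap /=.
have -> : #|A :&: Y| = ((a \in Y) + #|(A :\ a) :&: Y|)%N.
  rewrite (cardsD1 a) !inE aA; congr (_ + #|pred_of_set _|)%N.
  by apply/setP => x; rewrite !inE andbA.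
rewrite (cardsD1 b ((b |: A :\ a) :&: Y)%SET) !inE eqxx /=.
have -> : ((b |: A :\ a) :&: Y :\ b)%SET = ((A :\ a) :&: Y)%SET.
  apply/setP => x; rewrite !inE; case: (eqVneq x b) => //= ->.
  by rewrite (negPf bA) andbF.
lia.
Qed.

Lemma card_swap A a b : a \in A -> b \notin A -> #|swap A (a, b)| = #|A|.
Proof.
move=> aA bA; have := card_swapI _ finset.setT _ _ aA bA.
by rewrite !finset.setIT !inE => /addIn.
Qed.

Lemma swap_inj A : {in finset.setX A (~: A)%SET &, injective (swap A)}.
Proof.
move=> [a b] [a' b'] /finset.setXP[/= aA]; rewrite inE => bA /finset.setXP[/= a'A].
rewrite inE => b'A /setP E.
have bb' : b = b'.
  by apply/eqP; have := E b; rewrite !inE eqxx (negPf bA) !andbF !orbF => <-.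
subst b'; congr pair; apply/eqP; have := E a; rewrite !inE eqxx aA /= andbT orbF.
have /negPf-> : a != b by apply: contraNneq bA => <-.
by move=> /esym/negbFE.
Qed.

Lemma neighboursE A : #|A| = r -> (0 < r)%N ->
  [set B : {set 'I_n} | (#|B| == r) && (#|A :&: B| == r.-1)]%SET =
  (swap A @: finset.setX A (~: A))%SET.
Proof.
move=> Ar r0; apply/setP => B; rewrite inE; apply/idP/imsetP.
  move=> /andP[/eqP Br /eqP AB].
  have /cards1P[a aE] : #|A :\: B| == 1%N by rewrite cardsD Ar AB; apply/eqP; lia.
  have /cards1P[b bE] : #|B :\: A| == 1%N.
    by rewrite cardsD finset.setIC Br AB; apply/eqP; lia.
  have aAB x : (x \in A :\: B)%SET = (x == a) by rewrite aE inE.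
  have bBA x : (x \in B :\: A)%SET = (x == b) by rewrite bE inE.
  have := aAB a; rewrite !inE eqxx => /andP[aB aA].
  have := bBA b; rewrite !inE eqxx => /andP[bA bB].
  exists (a, b); first by rewrite !inE aA bA.
  apply/setP => x; have := aAB x; have := bBA x; rewrite !inE => <- <-.
  by case: (x \in A); case: (x \in B).
move=> [[a b] /finset.setXP[/= aA]]; rewrite inE => bA ->.
rewrite card_swap// Ar eqxx /= finset.setIC.
have := card_swapI _ A _ _ aA bA; rewrite finset.setIid aA (negPf bA) Ar.
by rewrite addn1 addn0 => <-.
Qed.

(** Each neighbour of [A] is the swap of exactly one pair, so a step averages over the removed and
    the added element. *)
Lemma sum_trans_prob A (f : {set 'I_n} -> R) : #|A| = r -> (0 < r)%N ->
  \sum_B trans_prob R r A B * f B =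
  (r * (n - r))%:R^-1 * \sum_(a in A) \sum_(b in (~: A)%SET) f (swap A (a, b)).
Proof.
move=> Ar r0.
transitivity ((r * (n - r))%:R^-1 * \sum_(B in (swap A @: finset.setX A (~: A))%SET) f B).
  rewrite mulr_sumr -neighboursE// [RHS]big_mkcond; apply: eq_bigr => B _.
  by rewrite /trans_prob Ar eqxx inE /=; case: ifP => // _; rewrite mul0r.
congr (_ * _); rewrite big_imset /=; last exact: swap_inj.
by rewrite pair_big /=; apply: eq_big => // -[a b]; rewrite finset.in_setX.
Qed.

Lemma trans_prob_ge0 A B : 0 <= trans_prob R r A B.
Proof. by rewrite /trans_prob; case: ifP => // _; rewrite invr_ge0. Qed.

Lemma trans_prob_out A B : B \notin rsets -> trans_prob R r A B = 0.
Proof. by rewrite inE /trans_prob => /negPf->; rewrite andbF. Qed.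

Lemma sum_trans_prob1 A : (0 < r < n)%N -> A \in rsets ->
  \sum_B trans_prob R r A B = 1.
Proof.
move=> /andP[r0 rn]; rewrite inE => /eqP Ar.
under eq_bigr do rewrite -[trans_prob _ _ _ _]mulr1.
rewrite sum_trans_prob//; under eq_bigr do rewrite sumr_const.
rewrite sumr_const cardsCs finset.setCK card_ord Ar -mulrnA mulnC mulVf//.
by rewrite pnatr_eq0 muln_eq0; lia.
Qed.

End Johnson.

(** * Explicit hitting times of the distance chain *)

Section HittingTime.
Context {R : realType}.
Implicit Types (n r i j d : nat).

(* The number of [r]-subsets at distance [j] from a given [r]-subset of [[n]]. *)
Definition sphere n r j : nat := ('C(r, j) * 'C(n - r, j))%N.

(* The expected time to get from distance [i.+1] to distance [i]: the stationary mass
   beyond [i] divided by the stationary flow from [i.+1] to [i], a step down having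
   probability [(i.+1)^2 / (r (n - r))]. *)
Definition descent n r i : R :=
  (r * (n - r))%:R * \sum_(i.+1 <= j < r.+1) (sphere n r j)%:R
    / ((sphere n r i.+1)%:R * (i.+1)%:R ^+ 2).

(** A step lowers the distance by at most 1, so every level below [d] is crossed and the passage
    times add up. *)
Definition hitting n r d : R := \sum_(0 <= i < d) descent n r i.

Lemma sphere_gt0 n r j : (r.*2 <= n)%N -> (j <= r)%N -> (0 < sphere n r j)%N.
Proof. by move=> rn jr; rewrite muln_gt0 !bin_gt0; lia. Qed.

(** Detailed balance: [(r - j)(n - r - j)] swaps lead up from distance [j], and [(j + 1)^2] lead
    down from [j + 1]. *)
Lemma sphereS n r j :
  (sphere n r j.+1 * j.+1 ^ 2 = (r - j) * (n - r - j) * sphere n r j)%N.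
Proof.
rewrite /sphere; have := mul_bin_left r j; have := mul_bin_left (n - r) j.
nia.
Qed.

(** The first-step equation at distance [d + 1], times [r (n - r)]. By [sphereS] both terms have
    denominator [sphere n r d.+1], and their numerators, the masses beyond [d + 1] and beyond [d],
    differ by that sphere. *)
Lemma descent_balance n r d : (r.*2 <= n)%N -> (d < r)%N ->
  ((r - d.+1) * (n - r - d.+1))%:R * descent n r d.+1 - (d.+1 ^ 2)%:R * descent n r d
  = - (r * (n - r))%:R.
Proof.
move=> rn dr; have S0 : (sphere n r d.+1)%:R != 0 :> R.
  by rewrite pnatr_eq0 -lt0n sphere_gt0.
have D0 : d.+1%:R != 0 :> R by rewrite pnatr_eq0.
rewrite {2}/descent -mulr_suml big_ltn; last by rewrite ltnS.
(* At the top distance no swap leads up and the mass beyond is 0; below it the upward weight [E0]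
   can be cancelled. *)
have [rd|rd] := eqVneq d.+1 r.
  subst r; rewrite subnn mul0n mul0r big_geq// addr0 natrX; field.
  by rewrite nat1r D0.
have SE : (sphere n r d.+2)%:R * d.+2%:R ^+ 2 =
    ((r - d.+1) * (n - r - d.+1))%:R * (sphere n r d.+1)%:R :> R.
  by rewrite -natrX -!natrM sphereS.
rewrite /descent -mulr_suml SE natrX.
have E0 : ((r - d.+1) * (n - r - d.+1))%:R != 0 :> R.
  by rewrite pnatr_eq0 muln_eq0; lia.
field; rewrite nat1r D0 S0 !pnatr_eq0 /=; lia.
Qed.

Lemma sum_sphere n r : (r <= n)%N -> (\sum_(0 <= j < r.+1) sphere n r j = 'C(n, r))%N.
Proof.
move=> rn; rewrite -{2}(subnK rn) -binomial.Vandermonde big_mkord.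
by apply: eq_bigr => -[j /= jr] _; rewrite /sphere bin_sub// mulnC.
Qed.

(** The [r (n - r)] sets at distance 1 cancel the prefactor, leaving the mass of all sets except the
    target. *)
Lemma descent0 n r : (0 < r < n)%N -> descent n r 0 = 'C(n, r)%:R - 1.
Proof.
move=> /andP[r0 rn]; rewrite -sum_sphere; last exact: ltnW.
rewrite big_ltn// natrD [sphere _ _ 0]/sphere !bin0 addrAC subrr add0r /descent -mulr_suml.
rewrite [sphere _ _ 1]/sphere !bin1 expr1n mulr1 mulrCA mulfV ?mulr1 ?natr_sum//.
by rewrite pnatr_eq0 muln_eq0; lia.
Qed.

Lemma descent_ge0 n r i : 0 <= descent n r i.
Proof. by rewrite mulr_ge0// sumr_ge0// => j _; rewrite divr_ge0// mulr_ge0// exprn_ge0. Qed.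

(** By [sphereS] the denominator is [(r - i - 1)(n - r - i - 1)] times the sphere of radius [i + 1].
    That sphere absorbs [n - r], and the other factor is at least [n - 2r]. *)
Lemma descentS_le n r i : (r.*2 < n)%N -> (i.+1 < r)%N ->
  descent n r i.+1 <= r%:R * 'C(n, r)%:R / (n - r.*2)%:R.
Proof.
move=> rn ir; rewrite /descent -mulr_suml -natrX -natrM sphereS mulrA.
have Sm : (n - r <= sphere n r i.+1)%N.
  rewrite -[leqLHS]mul1n leq_mul// ?bin_gt0; first exact: ltnW.
  by apply: leq_bin_id; lia.
rewrite ler_pdivrMr; last first.
  by rewrite ltr0n !muln_gt0 !bin_gt0; lia.
rewrite mulrAC ler_pdivlMr; last by rewrite ltr0n; lia.
rewrite -natr_sum -!natrM ler_nat.
have le : (\sum_(i.+2 <= j < r.+1) sphere n r j <= 'C(n, r))%N.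
  rewrite -sum_sphere; last by lia.
  by rewrite [leqRHS](@big_cat_nat _ _ _ i.+2)//= ?leq_addl//; lia.
set S := (\sum_(_ <= _ < _) _)%N in le *; set s := sphere _ _ _ in Sm *.
have h2 : (n - r.*2 <= (r - i.+1) * (n - r - i.+1))%N by nia.
have := leq_mul (leq_mul (leq_mul (leqnn r) Sm) le) h2.
by rewrite -/s; nia.
Qed.

Lemma hitting_lower n r d : (0 < r < n)%N -> (0 < d)%N ->
  'C(n, r)%:R - 1 <= hitting n r d.
Proof.
case: d => // d rn _; rewrite /hitting big_ltn// descent0// lerDl.
by rewrite sumr_ge0// => i _; exact: descent_ge0.
Qed.

(** The last level costs [N - 1]; each of the fewer than [r] others costs at most
    [r N / (n - 2r)]. *)
Lemma hitting_upper n r d : (0 < r)%N -> (r.*2 < n)%N -> (d <= r)%N ->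
  hitting n r d <= 'C(n, r)%:R * (1 + (r ^ 2)%:R / (n - r.*2)%:R).
Proof.
move=> r0 rn dr; have m0 : 0 < (n - r.*2)%:R :> R by rewrite ltr0n; lia.
case: d dr => [_|d dr].
  by rewrite /hitting big_geq// mulr_ge0// addr_ge0// divr_ge0.
rewrite /hitting big_ltn// descent0; last by lia.
rewrite big_add1 /= mulrDr mulr1 lerD// ?gerBl//.
apply: le_trans (_ : \sum_(0 <= i < d) (r%:R * 'C(n, r)%:R / (n - r.*2)%:R : R) <= _).
  by rewrite !big_mkord ler_sum// => -[i /= id] _; apply: descentS_le => //; lia.
rewrite sumr_const_nat subn0 -[leLHS]mulr_natr natrX.
have := ltnW dr; rewrite -(ler_nat R) => {}dr.
have : 0 <= r%:R * 'C(n, r)%:R / (n - r.*2)%:R * (r%:R - d%:R) :> R.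
  by rewrite mulr_ge0 ?subr_ge0// ?divr_ge0 ?mulr_ge0//.
by lra.
Qed.

End HittingTime.

(** * Two-sided bounds on the expected cover time *)

Section CoverTime.
Context {R : realType} {n r : nat}.
Hypotheses (r_gt0 : (0 < r)%N) (rn : (r.*2 < n)%N).
Implicit Types (A B Y : {set 'I_n}) (k : nat).

Let N : R := 'C(n, r)%:R.
Let rsets := @rsets n r.
Let P := @trans_prob R n r.
Let hit A Y : R := hitting n r #|(A :\: Y)%SET|.
Let hmax : R := N * (1 + (r ^ 2)%:R / (n - r.*2)%:R).

Let lt_rn : (0 < r < n)%N. Proof. by lia. Qed.

Lemma hitting_step A Y : A \in rsets -> Y \in rsets -> A != Y ->
  \sum_B P A B * hit B Y = hit A Y - 1.
Proof.
rewrite !inE => /eqP Ar /eqP Yr AY; rewrite /P sum_trans_prob// /hit.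
have : (0 < #|(A :\: Y)%SET|)%N.
  rewrite card_gt0 finset.setD_eq0; apply: contraNN AY => AY.
  by rewrite eqEcard AY Ar Yr leqnn.
case dE : #|(A :\: Y)%SET| => [//|d] _.
have dr : (d < r)%N by rewrite -dE -Ar subset_leq_card// finset.subsetDl.
(* The change of hitting time under a swap. Products of indicators in [a] and [b] let the double sum
   factor. *)
pose g a b : R := descent n r d.+1 * ((a \in Y)%:R * (b \notin Y)%:R)
   - descent n r d * ((a \notin Y)%:R * (b \in Y)%:R).
have gE a b : a \in A -> b \notin A ->
    hitting n r #|(swap A (a, b) :\: Y)%SET| = hitting n r d.+1 + g a b.
  move=> aA bA; have := card_swapI A (~: Y)%SET _ _ aA bA.
  rewrite -!finset.setDE dE !inE /g.
  have hS j : hitting n r j.+1 = hitting n r j + descent n r j :> R.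
    by rewrite /hitting big_nat_recr.
  case: (a \in Y); case: (b \in Y) => /=.
  - by rewrite !addn0 => ->; ring.
  - by rewrite addn0 addn1 => ->; rewrite [in LHS]hS; ring.
  - by rewrite addn0 addn1 => -[->]; rewrite [in RHS]hS; ring.
  - by rewrite !addn1 => -[->]; ring.
transitivity ((r * (n - r))%:R^-1 *
    (\sum_(a in A) \sum_(b in (~: A)%SET) (hitting n r d.+1 + g a b))).
  congr (_ * _); apply: eq_bigr => a aA; apply: eq_bigr => b.
  by rewrite inE => bA; exact: gE.
have cA : #|(~: A)%SET| = (n - r)%N by rewrite cardsCs finset.setCK card_ord Ar.
(* By these four counts, [(r - d - 1)(n - r - d - 1)] swaps lead away from [Y] and [(d + 1)^2] lead
   towards it. *)
have c1 : \sum_(a in A) (a \notin Y)%:R = d.+1%:R :> R.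
  rewrite -dE -sum1_card natr_sum big_mkcond [RHS]big_mkcond; apply: eq_bigr => i _.
  by rewrite !inE; case: (i \in A); case: (i \in Y).
have c2 : \sum_(a in A) (a \in Y)%:R = (r - d.+1)%:R :> R.
  have <- : #|(A :&: Y)%SET| = (r - d.+1)%N by have := cardsID Y A; lia.
  rewrite -sum1_card natr_sum big_mkcond [RHS]big_mkcond; apply: eq_bigr => i _.
  by rewrite !inE; case: (i \in A); case: (i \in Y).
have c3 : \sum_(b in (~: A)%SET) (b \in Y)%:R = d.+1%:R :> R.
  have <- : #|(Y :\: A)%SET| = d.+1.
    by have := cardsID Y A; have := cardsID A Y; rewrite finset.setIC; lia.
  rewrite -sum1_card natr_sum big_mkcond [RHS]big_mkcond; apply: eq_bigr => i _.
  by rewrite !inE; case: (i \in A); case: (i \in Y).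
have c4 : \sum_(b in (~: A)%SET) (b \notin Y)%:R = (n - r - d.+1)%:R :> R.
  have : \sum_(b in (~: A)%SET) ((b \in Y)%:R + (b \notin Y)%:R) = (n - r)%:R :> R.
    by rewrite -cA -sum1_card natr_sum; apply: eq_bigr => i _; case: (i \in Y); rewrite ?addr0 ?add0r.
  rewrite big_split /= c3 => /(canRL (addKr _)) ->.
  by rewrite [in RHS]natrB 1?addrC//; lia.
have -> : \sum_(a in A) \sum_(b in (~: A)%SET) (hitting n r d.+1 + g a b) =
    (r * (n - r))%:R * hitting n r d.+1 +
    (((r - d.+1) * (n - r - d.+1))%:R * descent n r d.+1 - (d.+1 ^ 2)%:R * descent n r d).
  under eq_bigr do rewrite big_split /= sumr_const cA.
  rewrite big_split /= sumr_const Ar -mulrnA mulnC -[in LHS]mulr_natl; congr (_ + _).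
  under eq_bigr => a _.
    rewrite sumrB -!mulr_sumr c3 c4; over.
  by rewrite sumrB -!mulr_sumr -!mulr_suml c1 c2 natrM natrX; ring.
rewrite descent_balance//; last exact: ltnW.
have : (r * (n - r))%:R != 0 :> R by rewrite pnatr_eq0 muln_eq0; lia.
by move=> H; rewrite mulrDr mulrA mulVf// mul1r mulrN mulVf.
Qed.

Lemma hit_diag A : hit A A = 0.
Proof. by rewrite /hit finset.setDv cards0 /hitting big_geq. Qed.

Lemma hit_bounds A Y : A \in rsets -> Y \in rsets -> A != Y ->
  N - 1 <= hit A Y <= hmax.
Proof.
rewrite !inE => /eqP Ar /eqP Yr AY; apply/andP; split.
  apply: hitting_lower => //; rewrite card_gt0 finset.setD_eq0.
  by apply: contraNN AY => AY; rewrite eqEcard AY Ar Yr leqnn.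
by apply: hitting_upper => //; rewrite -Ar subset_leq_card// finset.subsetDl.
Qed.

Lemma card_rsets : #|rsets| = 'C(n, r).
Proof. by rewrite card_draws card_ord. Qed.

Lemma N_ge1 : 1 <= N.
Proof. by rewrite ler1n bin_gt0; lia. Qed.

Lemma init_prob_ge0 A : 0 <= init_prob R r A.
Proof. by rewrite /init_prob; case: ifP => // _; rewrite invr_ge0. Qed.

Lemma sum_init_prob : \sum_(A : {set 'I_n}) init_prob R r A = 1.
Proof.
rewrite -big_mkcond /= sumr_const -[_ *+ _]mulr_natl.
have -> : #|[pred A : {set 'I_n} | #|A| == r]| = 'C(n, r).
  by rewrite -card_rsets; apply: eq_card => A; rewrite !inE.
by rewrite mulfV// pnatr_eq0 -lt0n bin_gt0; lia.
Qed.

Lemma init_prob_sum_le (f g : {set 'I_n} -> R) :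
  (forall A, A \in rsets -> f A <= g A) ->
  \sum_A init_prob R r A * f A <= \sum_A init_prob R r A * g A.
Proof.
move=> fg; apply: ler_sum => A _; rewrite /init_prob.
have := fg A; rewrite inE; case: eqP => [_|_ _]; last by rewrite !mul0r.
by move=> /(_ isT); apply: ler_wpM2l; rewrite invr_ge0.
Qed.

Lemma tail_prob_ge0 k : 0 <= tail_prob R n r k.
Proof.
case: k => [|k]; first by rewrite tail_prob0//; lia.
rewrite tail_probS sumr_ge0// => A _; rewrite mulr_ge0 ?init_prob_ge0//.
by apply: uncovered_prob_ge0 => *; exact: trans_prob_ge0.
Qed.

Lemma sum_tail_prob k : series (tail_prob R n r) k.+1 =
  1 + \sum_A init_prob R r A * \sum_(i < k) uncovered_prob P i A (rsets :\ A)%SET.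
Proof.
rewrite /series /= big_nat_recl// tail_prob0; last by lia.
rewrite big_mkord; under [in LHS]eq_bigr do rewrite tail_probS.
rewrite exchange_big /=; congr (_ + _); apply: eq_bigr => A _.
by rewrite mulr_sumr.
Qed.

Lemma card_rsetsD1 A : A \in rsets -> #|(rsets :\ A)%SET| = 'C(n, r).-1.
Proof. by move=> Ar; rewrite -card_rsets (cardsD1 A rsets) Ar. Qed.

Lemma sum_tail_prob_upper k :
  series (tail_prob R n r) k <= 1 + hmax * series harmonic 'C(n, r).-1.
Proof.
apply: (@le_trans _ _ (series (tail_prob R n r) k.+1)).
  by rewrite /series /= big_nat_recr//= lerDl tail_prob_ge0.
rewrite sum_tail_prob lerD2l.
rewrite -[leRHS]mul1r -{1}sum_init_prob mulr_suml; apply: init_prob_sum_le => A Ar.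
have Ahit Y : Y \in (rsets :\ A)%SET -> hit A Y <= hmax.
  move=> /setD1P[YA Yr]; have AY : A != Y by rewrite eq_sym.
  by case/andP: (hit_bounds A Y Ar Yr AY).
rewrite -(card_rsetsD1 _ Ar); apply: le_trans (matthews_le _ _ _ _ Ahit).
apply: (matthews_upper P rsets hit) => //.
- exact: trans_prob_ge0.
- by move=> B Br; exact: sum_trans_prob1.
- exact: trans_prob_out.
- exact: hit_diag.
- exact: hitting_step.
- move=> B Y Br Yr BY; have /andP[h1 ->] := hit_bounds B Y Br Yr BY; rewrite andbT.
  by apply: le_trans h1; rewrite subr_ge0 N_ge1.
- exact: subD1set.
- by rewrite !inE eqxx.
Qed.

Lemma sum_tail_prob_lower : exists C : R, forall k,
  1 + (N - 1) * series harmonic 'C(n, r).-1 <=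
  series (tail_prob R n r) k.+1 + C * tail_prob R n r k.+1.
Proof.
(* A crude bound over finitely many pairs; what matters is that it does not depend on [k]. *)
pose C : R := \sum_A \sum_(U : {set {set 'I_n}}) `|matthews hit (N - 1) A U|.
have matthewsC A U : matthews hit (N - 1) A U <= C.
  apply: le_trans (ler_norm _) _; rewrite /C (bigD1 A)//= (bigD1 U)//= -addrA lerDl.
  by rewrite addr_ge0 ?sumr_ge0// => B _; rewrite sumr_ge0.
exists C => k; rewrite sum_tail_prob tail_probS -addrA lerD2l.
rewrite mulr_sumr -big_split /=.
under [leRHS]eq_bigr => A _ do rewrite mulrCA -mulrDr.
rewrite -[leLHS]mul1r -{1}sum_init_prob mulr_suml; apply: init_prob_sum_le => A Ar.
have Ahit Y : Y \in (rsets :\ A)%SET -> N - 1 <= hit A Y.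
  move=> /setD1P[YA Yr]; have AY : A != Y by rewrite eq_sym.
  by case/andP: (hit_bounds A Y Ar Yr AY).
rewrite -(card_rsetsD1 _ Ar); apply: le_trans (matthews_ge _ _ _ _ Ahit) _.
apply: (matthews_lower P rsets hit) => //.
- exact: trans_prob_ge0.
- by move=> B Br; exact: sum_trans_prob1.
- exact: trans_prob_out.
- exact: hit_diag.
- exact: hitting_step.
- by move=> B Y Br Yr BY; have /andP[] := hit_bounds B Y Br Yr BY.
- exact: subD1set.
- by rewrite !inE eqxx.
Qed.

(** The upper bound makes the series of tails converge, so its terms tend to 0, which removes the
    [C] term from the lower bound. *)
Lemma expected_cover_time_bounds : exists2 l : R,
  expected_cover_time R n r = l%:E &
  1 + (N - 1) * series harmonic 'C(n, r).-1 <= l <=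
  1 + hmax * series harmonic 'C(n, r).-1.
Proof.
have cvg_tail : cvgn (series (tail_prob R n r)).
  apply: nondecreasing_is_cvgn.
    apply: nondecreasing_series => k _ _; exact: tail_prob_ge0.
  exists (1 + hmax * series harmonic 'C(n, r).-1) => _ [k _ <-].
  exact: sum_tail_prob_upper.
exists (limn (series (tail_prob R n r))).
  rewrite /expected_cover_time -EFin_lim//; congr (limn _).
  by apply/funext => k; rewrite /= sumEFin.
apply/andP; split; last first.
  by apply: limr_le => //; near=> k; exact: sum_tail_prob_upper.
have [C lowerC] := sum_tail_prob_lower.
have cvgC : series (tail_prob R n r) k.+1 + C * tail_prob R n r k.+1 @[k --> \oo] -->
    limn (series (tail_prob R n r)) + C * 0.
  apply: cvgD; first by rewrite (cvg_shiftS (series _)).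
  by apply: cvgMr; rewrite (cvg_shiftS (tail_prob _ _ _)); exact: cvg_series_cvg_0.
rewrite mulr0 addr0 in cvgC; rewrite -(cvg_lim _ cvgC)//.
apply: limr_ge; first exact: cvgP cvgC.
by near=> k; exact: lowerC.
Unshelve. all: by end_near. Qed.

End CoverTime.

(** * Harmonic numbers, logarithms and the limit in [n] *)

Lemma ln_le_harmonic {R : realType} (m : nat) : ln m.+1%:R <= series harmonic m :> R.
Proof.
elim: m => [|m IH]; first by rewrite ln1 /series /= big_geq.
rewrite /series /= big_nat_recr//=.
have -> : m.+2%:R = m.+1%:R * (1 + harmonic m) :> R.
  by rewrite mulrDr mulr1 mulfV// -natr1.
have hm : 0 < harmonic m :> R by rewrite invr_gt0.
rewrite lnM ?posrE ?addr_gt0// lerD//.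
by apply: le_ln1Dx; apply: lt_trans hm.
Qed.

(** Inductively, [ln (m + 2) = ln (m + 1) - ln (1 - 1/(m + 2))], and [ln (1 - x) <= - x]. *)
Lemma harmonic_le_ln {R : realType} (m : nat) : series harmonic m.+1 <= 1 + ln m.+1%:R :> R.
Proof.
elim: m => [|m IH].
  by rewrite ln1 addr0 /series /= big_nat1 /harmonic /= invr1.
rewrite /series /= big_nat_recr//=.
have e : m.+2%:R = m.+1%:R / (1 - harmonic m.+1) :> R.
  have -> : 1 - harmonic m.+1 = m.+1%:R / m.+2%:R :> R.
    apply: (@mulIf _ (m.+2%:R : R)); rewrite ?pnatr_eq0// mulrBl mul1r mulVf ?pnatr_eq0//.
    by rewrite divfK ?pnatr_eq0// -(natr1 m.+1) addrK.
  by rewrite invf_div mulrCA mulfV ?mulr1// pnatr_eq0.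
have hm : harmonic m.+1 < 1 :> R by rewrite /harmonic /= invf_lt1// ltr1n.
rewrite [X in ln X]e ln_div ?posrE ?subr_gt0// addrA lerD// lerNr.
by apply: le_ln1Dx; rewrite ltrN2.
Qed.

Lemma cvg_ln_natr {R : realType} : (ln n%:R : R) @[n --> \oo] --> +oo.
Proof.
apply/cvgryPge => A; near=> n.
rewrite -[leLHS]expRK ler_ln ?posrE ?expR_gt0//.
  by near: n; exact: nbhs_infty_ger.
by rewrite ltr0n; near: n; exact: nbhs_infty_gt.
Unshelve. all: by end_near. Qed.

Lemma cvg_subn_inv {R : realType} (m : nat) : ((n - m)%:R^-1 : R) @[n --> \oo] --> 0.
Proof.
apply/gtr0_cvgV0.
  by near=> n; rewrite ltr0n subn_gt0; near: n; exact: nbhs_infty_gt.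
by apply/cvgrnyP; exact: cvg_subnr.
Unshelve. all: by end_near. Qed.

Theorem theorem4 (R : realType) (r : nat) (hr : (1 <= r)%N) :
  exists f : nat -> R, f @ \oo --> 0 /\
    \forall n \near \oo,
      expected_cover_time R n r =
      ((('C(n, r))%:R * ln (('C(n, r))%:R)) * (1 + f n))%:E.
Proof.
pose N n : R := 'C(n, r)%:R.
(* Solved from the required equation; [fine] loses nothing once [n > 2r], where the expectation is
   finite. *)
exists (fun n => fine (expected_cover_time R n r) / (N n * ln (N n)) - 1).
have N_large n : (r.*2 < n)%N -> [/\ 2 <= n%:R :> R, n%:R <= N n & 0 < ln (n%:R : R)].
  move=> rn; have n2 : (2 <= n)%N by lia.
  split; first by rewrite ler_nat.
    by rewrite ler_nat leq_bin_id//; lia.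
  by rewrite ln_gt0// ltr1n.
have lnN n : (r.*2 < n)%N -> 0 < ln (n%:R : R) <= ln (N n).
  move=> /N_large[n2 nN n0]; rewrite n0 ler_ln ?posrE//; last by lra.
  exact: lt_le_trans n2.
split; last first.
  near=> n; have rn : (r.*2 < n)%N by near: n; exact: nbhs_infty_gt.
  have [l -> _] := @expected_cover_time_bounds R _ _ hr rn.
  have [n2 nN n0] := N_large _ rn; have /andP[_ nlN] := lnN _ rn.
  have N0 : N n != 0 by rewrite gt_eqF//; lra.
  have L0 : ln (N n) != 0 by rewrite gt_eqF//; lra.
  by rewrite -/(N n) addrC subrK /= mulrC divfK// mulf_neq0.
pose a n : R := (r ^ 2)%:R / (n - r.*2)%:R.
(* With [L = ln N]: below, [(N - 1) L >= N L (1 - 1/n)] as [N >= n]; above,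
   [1 + N (1 + a)(1 + L) <= N (1 + a)(L + 2)] and [L >= ln n]. Writing [n - 0] fits
   [cvg_subn_inv]. *)
apply: (@squeeze_cvgr _ _ _ _ (fun n => - (n - 0)%:R^-1)
    (fun n => (1 + a n) * (1 + 2 * (ln n%:R)^-1) - 1)).
- near=> n; have rn : (r.*2 < n)%N by near: n; exact: nbhs_infty_gt.
  have [l -> /= /andP[lo up]] := @expected_cover_time_bounds R _ _ hr rn.
  have [n2 nN n0] := N_large _ rn; have /andP[_ nlN] := lnN _ rn.
  rewrite -/(N n) -/(a n) in lo up.
  have a0 : 0 <= a n by rewrite divr_ge0.
  (* The harmonic index is [N - 1], so [ln N <= H_(N-1) <= H_N <= 1 + ln N]. *)
  have Nm : 'C(n, r) = 'C(n, r).-1.+1 by rewrite prednK// bin_gt0; lia.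
  set H := series _ _ in lo up; set L := ln (N n) in nlN *.
  have LH : L <= H by rewrite /L /N Nm; exact: ln_le_harmonic.
  have HL : H <= 1 + L.
    apply: le_trans (_ : series harmonic 'C(n, r).-1.+1 <= _).
      by rewrite /H /series /= [leRHS]big_nat_recr//= lerDl invr_ge0.
    by rewrite /L /N {2}Nm; exact: harmonic_le_ln.
  have N1 : 1 <= N n by lra.
  have L0 : 0 < L by lra.
  have NL0 : 0 < N n * L by rewrite mulr_gt0//; lra.
  rewrite subn0 lerBrDl lerD2r ler_pdivlMr// ler_pdivrMr//; apply/andP; split.
    have : 1 <= N n / n%:R by rewrite ler_pdivlMr ?mul1r//; lra.
    move=> /(ler_wpM2r (ltW L0)); have := ler_wpM2l (_ : 0 <= N n - 1) LH.
    by rewrite subr_ge0 => /(_ N1); lra.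
  have := ler_wpM2r (_ : 0 <= (ln n%:R)^-1) nlN.
  rewrite invr_ge0 mulfV ?gt_eqF// => /(_ (ltW n0)) nL.
  have Na : 1 <= N n * (1 + a n) by rewrite mulr_ege1// lerDl.
  have Na0 : 0 <= N n * (1 + a n) by lra.
  have := ler_wpM2l Na0 nL; have := ler_wpM2l Na0 HL; lra.
- rewrite -oppr0; apply: cvgN; exact: cvg_subn_inv.
- have -> : 0 = (1 + (r ^ 2)%:R * 0) * (1 + 2 * 0) - 1 :> R by ring.
  apply: cvgB; last exact: cvg_cst.
  apply: cvgM; (apply: cvgD; first exact: cvg_cst); apply: cvgMr.
    exact: cvg_subn_inv.
  apply/gtr0_cvgV0; last exact: cvg_ln_natr.
  near=> n; have /lnN/andP[] // : (r.*2 < n)%N by near: n; exact: nbhs_infty_gt.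
Unshelve. all: by end_near. Qed.
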